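(* Let $f,g\in\mathcal B_1(2^\omega)\setminus\mathcal B_0(2^\omega)$. Then $f\le_{\mathbf{tt}} g$ if and only if $|f|_\alpha\lesssim|g|_\alpha$.
   Context: $\mathcal B_0(2^\omega)$: continuous functions $2^\omega\to\mathbb R$; $\mathcal B_1(2^\omega)$: pointwise limits of sequences of continuous functions. Optimal derivation sequence: for $\mathcal C\subseteq\mathcal P(X)$, $X$ a compact metric space, define $P^0=X$, $P^{\nu+1}=P^\nu\setminus\bigcup\{U\subseteq X \text{ open}: P^\nu\cap U\subseteq C\text{ for some }C\in\mathcal C\}$, and $P^\lambda=\bigcap_{\nu<\lambda}P^\nu$ for limit $\lambda$. Bourgain rank: for $f\in\mathcal B_1(2^\omega)$, $p\in\mathbb Q$, $\varepsilon\in\mathbb Q^+$, let $P^\nu_{f,p,\varepsilon}$ be the optimal derivation sequence for $\{f^{-1}((-\infty,p+\varepsilon)),f^{-1}((p-\varepsilon,\infty))\}$, let $\alpha(f,p,\varepsilon)$ be the least $\nu$ with $P^\nu_{f,p,\varepsilon}=\emptyset$, and $|f|_\alpha=\sup_{p,\varepsilon}\alpha(f,p,\varepsilon)$. Ordinal coarsening: $\alpha\lesssim\beta$ means that for every $\gamma<\alpha$ there are $\delta<\beta$ and $n\in\omega$ with $\gamma<\delta\cdot n$. Questions: for $y\in\mathbb R$, $p\in\mathbb Q$, $\varepsilon\in\mathbb Q^+$, a bit $b\in\{0,1\}$ is a correct answer to ''$y\lesssim_\varepsilon p$'' if either $b=1$ and $y<p+\varepsilon$, or $b=0$ and $y>p-\varepsilon$.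 $tt$-reducibility: $f\le_{\mathbf{tt}} g$ means: for every $p\in\mathbb Q,\varepsilon\in\mathbb Q^+$ there are $r\in\omega$, rationals $q_i$ and $\delta_i>0$ ($i<r$), continuous $k_i:2^\omega\to2^\omega$ ($i<r$) and a function $h:2^r\to\{0,1\}$ such that for every $A\in2^\omega$ and every $\sigma\in2^r$ such that each $\sigma(i)$ is a correct answer to $g(k_i(A))\lesssim_{\delta_i}q_i$, $h(\sigma)$ is a correct answer to $f(A)\lesssim_\varepsilon p$. *)

(* Defs.v *)
From Stdlib Require Import Reals QArith List.
Open Scope R_scope.

Definition Cantor := nat -> bool.

Definition agree (x y : Cantor) (n : nat) : Prop :=
  forall i, (i < n)%nat -> x i = y i.

Definition is_open (U : Cantor -> Prop) : Prop :=
  forall x, U x -> exists n, forall y, agree x y n -> U y.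

Definition cont_real (f : Cantor -> R) : Prop :=
  forall x (eps : R), 0 < eps ->
    exists n, forall y, agree x y n -> Rabs (f x - f y) < eps.

Definition cont_cantor (k : Cantor -> Cantor) : Prop :=
  forall x m, exists n, forall y, agree x y n -> agree (k x) (k y) m.

Definition Baire0 (f : Cantor -> R) : Prop := cont_real f.

Definition Baire1 (f : Cantor -> R) : Prop :=
  exists fs : nat -> Cantor -> R,
    (forall n, cont_real (fs n)) /\ (forall x, Un_cv (fun n => fs n x) (f x)).

(** Countable ordinals as Brouwer trees *)
Inductive Ord : Type :=
| OZ : Ord
| OS : Ord -> Ord
| OL : (nat -> Ord) -> Ord.  (* supremum of a sequence *)

Inductive ole : Ord -> Ord -> Prop :=
| ole_Z : forall b, ole OZ b
| ole_S : forall a b, olt a b -> ole (OS a) b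
| ole_L : forall f b, (forall n, ole (f n) b) -> ole (OL f) b
with olt : Ord -> Ord -> Prop :=
| olt_S : forall a b, ole a b -> olt a (OS b)
| olt_L : forall a f n, olt a (f n) -> olt a (OL f).

Fixpoint oadd (a b : Ord) : Ord :=
  match b with
  | OZ => a
  | OS b' => OS (oadd a b')
  | OL f => OL (fun n => oadd a (f n))
  end.

Fixpoint omuln (d : Ord) (n : nat) : Ord :=
  match n with
  | O => OZ
  | S n' => oadd (omuln d n') d
  end.

Definition ocoarse (a b : Ord) : Prop :=
  forall g, olt g a -> exists d n, olt d b /\ olt g (omuln d n).

Definition derive (CC : (Cantor -> Prop) -> Prop) (P : Cantor -> Prop) : Cantor -> Prop :=
  fun x => P x /\
    ~ (exists U, is_open U /\ U x /\
         exists C, CC C /\ (forall y, P y -> U y -> C y)).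

Fixpoint deriv_seq (CC : (Cantor -> Prop) -> Prop) (nu : Ord) : Cantor -> Prop :=
  match nu with
  | OZ => fun _ => True
  | OS nu' => derive CC (deriv_seq CC nu')
  | OL f => fun x => forall n, deriv_seq CC (f n) x
  end.

Definition fam (f : Cantor -> R) (p eps : Q) : (Cantor -> Prop) -> Prop :=
  fun C => C = (fun x => f x < Q2R p + Q2R eps) \/ C = (fun x => f x > Q2R p - Q2R eps).

Definition is_alpha (f : Cantor -> R) (p eps : Q) (a : Ord) : Prop :=
  (forall x, ~ deriv_seq (fam f p eps) a x) /\
  (forall b, (forall x, ~ deriv_seq (fam f p eps) b x) -> ole a b).

Definition is_brank (f : Cantor -> R) (a : Ord) : Prop :=
  (forall p eps x, (0 < eps)%Q -> is_alpha f p eps x -> ole x a) /\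
  (forall c, (forall p eps x, (0 < eps)%Q -> is_alpha f p eps x -> ole x c) -> ole a c).

Definition correct (b : bool) (y : R) (p eps : Q) : Prop :=
  (b = true /\ y < Q2R p + Q2R eps) \/ (b = false /\ y > Q2R p - Q2R eps).

Definition tt_le (f g : Cantor -> R) : Prop :=
  forall (p eps : Q), (0 < eps)%Q ->
    exists (r : nat) (q delta : nat -> Q) (k : nat -> Cantor -> Cantor)
           (h : list bool -> bool),
      (forall i, (i < r)%nat -> (0 < delta i)%Q) /\
      (forall i, (i < r)%nat -> cont_cantor (k i)) /\
      (forall (A : Cantor) (sigma : list bool), length sigma = r ->
         (forall i, (i < r)%nat -> correct (nth i sigma false) (g (k i A)) (q i) (delta i)) ->
         correct (h sigma) (f A) p eps).

(* Main.v *)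
From Stdlib Require Import Reals QArith Qreals List Lra Lia Classical ClassicalEpsilon FunctionalExtensionality PropExtensionality.
Require Import Defs.

(** Forward direction. If [f] at [(p, e)] is decided by questions [V_i] to [g], then
    deriving once from an intersection of sets [P_i^(nu_i)] puts every remaining point
    into some [P_i^(nu_i + 1)]. By induction on [x] the same holds with [1] replaced by
    [omega^x]: at successor steps one follows the sum of the multiplicities of
    [omega^x] gained by the individual questions. So if all ranks of the questions are
    below [omega^x * n], the rank of [f] at [(p, e)] is below a finite multiple of
    [omega^x]. Working with powers of omega avoids natural sums.

    Backward direction. If [y] survives [d] derivations for [g], then a single question
    to [g] decides [f] on the difference of [P_f^theta] and [P_f^(theta + d)]: the output
    follows a point of [P_g^nu] giving the answer suited to [P_f^nu] near the input; when
    the input is seen to leave [P_f^nu], it switches to a nearby point with smaller [nu].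
    If [P_f^(d * n)] is empty, [n] such questions suffice, together with [n] questions
    deciding membership in the closed sets [P_f^(d * j)], which a discontinuity of [g]
    makes possible. *)

Open Scope nat_scope.

(** * Brouwer ordinals *)

Scheme ole_mut := Induction for ole Sort Prop
  with olt_mut := Induction for olt Sort Prop.
Combined Scheme ole_olt_ind from ole_mut, olt_mut.

Lemma ole_S_inv a b : ole (OS a) b -> olt a b.
Proof. now inversion 1. Qed.

Lemma ole_L_inv h b : ole (OL h) b -> forall n, ole (h n) b.
Proof. now inversion 1. Qed.

Lemma olt_Z_inv a : ~ olt a OZ.
Proof. now inversion 1. Qed.

Lemma olt_S_inv a b : olt a (OS b) -> ole a b.
Proof. now inversion 1. Qed.

Lemma olt_L_inv a h : olt a (OL h) -> exists n, olt a (h n).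
Proof. inversion 1; eauto. Qed.

Lemma ole_lub a h n : ole a (h n) -> ole a (OL h).
Proof.
  revert h n; induction a as [|a IH|g IH]; intros h n H.
  - constructor.
  - constructor. apply olt_L with n. now apply ole_S_inv.
  - constructor. intros m. eapply IH. eapply ole_L_inv; eauto.
Qed.

Lemma ole_refl a : ole a a.
Proof.
  induction a as [|a IH|g IH].
  - constructor.
  - constructor. now constructor.
  - constructor. intros n. now apply ole_lub with n.
Qed.

Lemma ole_olt_ole_trans :
  (forall a b, ole a b -> forall c, ole b c -> ole a c) /\
  (forall a b, olt a b -> forall c, ole b c -> olt a c).
Proof.
  apply (ole_olt_ind (fun a b _ => forall c, ole b c -> ole a c)
                     (fun a b _ => forall c, ole b c -> olt a c)).
  - constructor.
  - intros a b _ IH c H. constructor. auto.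
  - intros h b _ IH c H. constructor. auto.
  - intros a b _ IH c H. apply ole_S_inv in H.
    induction c as [|c IHc|h IHc].
    + now apply olt_Z_inv in H.
    + constructor. apply IH. now apply olt_S_inv.
    + apply olt_L_inv in H. destruct H as [n H]. apply olt_L with n. auto.
  - intros a h n _ IH c H. apply IH. now apply ole_L_inv.
Qed.

Lemma ole_trans a b c : ole a b -> ole b c -> ole a c.
Proof. intros H; now apply ole_olt_ole_trans. Qed.

Lemma olt_ole_trans a b c : olt a b -> ole b c -> olt a c.
Proof. intros H; now apply ole_olt_ole_trans. Qed.

Lemma ole_olt_trans a b c : ole a b -> olt b c -> olt a c.
Proof.
  intros H; induction c as [|c IH|h IH]; intros K.
  - now apply olt_Z_inv in K.
  - constructor. apply ole_trans with b; [easy|now apply olt_S_inv].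
  - apply olt_L_inv in K. destruct K as [n K]. apply olt_L with n. auto.
Qed.

Lemma ole_succ a : ole a (OS a).
Proof.
  induction a as [|a IH|h IH].
  - constructor.
  - constructor. now constructor.
  - constructor. intros n. apply ole_trans with (OS (h n)); [easy|].
    constructor. constructor. apply ole_lub with n. apply ole_refl.
Qed.

Lemma olt_ole a b : olt a b -> ole a b.
Proof.
  intros H. apply ole_trans with (OS a); [apply ole_succ|now constructor].
Qed.

Lemma ole_or_olt a b : ole a b \/ olt b a.
Proof.
  (* The successor case needs the comparison with the roles exchanged, since [ole (OS a) b] amounts
     to [olt a b]. *)
  assert (swap : forall a, (forall b, ole a b \/ olt b a) ->
                           forall b, ole b a \/ olt a b).
  { intros a' H c; induction c as [|c IH|h IH].
    - left; constructor.
    - destruct (H c); [right; now constructor|left; now constructor].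
    - destruct (classic (exists n, olt a' (h n))) as [[n K]|K].
      + right. now apply olt_L with n.
      + left. constructor. intros n. destruct (IH n); [easy|].
        exfalso; eauto. }
  revert b; induction a as [|a IH|h IH]; intros b.
  - left; constructor.
  - destruct (swap _ IH b); [right; now constructor|left; now constructor].
  - destruct (classic (exists n, olt b (h n))) as [[n K]|K].
    + right. now apply olt_L with n.
    + left. constructor. intros n. destruct (IH n b); [easy|].
      exfalso; eauto.
Qed.

Lemma olt_wf : well_founded olt.
Proof.
  assert (H : forall a c, olt c a -> Acc olt c).
  { induction a as [|a IH|h IH]; intros c H.
    - now apply olt_Z_inv in H.
    - constructor. intros d Hd. apply IH. apply olt_S_inv in H.
      now apply olt_ole_trans with c.
    - apply olt_L_inv in H. destruct H as [n H]. eauto. }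
  intros a. apply H with (OS a). constructor. apply ole_refl.
Qed.

Lemma olt_irrefl a : ~ olt a a.
Proof. induction (olt_wf a) as [a _ IH]. intros H. exact (IH a H H). Qed.

Lemma least_ord (P : Ord -> Prop) :
  (exists a, P a) -> exists a, P a /\ forall b, P b -> ole a b.
Proof.
  intros [a Ha]. revert Ha. induction (olt_wf a) as [a _ IH]. intros Ha.
  destruct (classic (exists b, P b /\ olt b a)) as [[b [Hb K]]|K].
  - exact (IH b K Hb).
  - exists a. split; [easy|]. intros b Hb. destruct (ole_or_olt a b); [easy|].
    exfalso; eauto.
Qed.

Lemma finite_max_index (h : nat -> Ord) (r : nat) (w : nat -> nat) :
  exists n, forall i, i < r -> ole (h (w i)) (h n).
Proof.
  induction r as [|r [n Hn]].
  - exists 0. lia.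
  - destruct (ole_or_olt (h n) (h (w r))) as [K|K].
    + exists (w r). intros i Hi. destruct (Nat.eq_dec i r) as [->|Hne].
      * apply ole_refl.
      * apply ole_trans with (h n); [apply Hn; lia|easy].
    + exists n. intros i Hi. destruct (Nat.eq_dec i r) as [->|Hne].
      * now apply olt_ole.
      * apply Hn; lia.
Qed.

Lemma finite_upper_bound (b c0 : Ord) (r : nat) (c : nat -> Ord) :
  olt c0 b -> (forall i, i < r -> olt (c i) b) ->
  exists d, olt d b /\ ole c0 d /\ forall i, i < r -> ole (c i) d.
Proof.
  intros H0 H.
  induction r as [|r IH].
  - exists c0. repeat split; [easy|apply ole_refl|lia].
  - destruct IH as [d [D1 [D2 D3]]]; [intros; apply H; lia|].
    destruct (ole_or_olt d (c r)) as [L|L].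
    + exists (c r). split; [apply H; lia|]. split; [now apply ole_trans with d|].
      intros i Hi. destruct (Nat.eq_dec i r) as [->|Hne]; [apply ole_refl|].
      apply ole_trans with d; [apply D3; lia|easy].
    + exists d. repeat split; try easy. intros i Hi.
      destruct (Nat.eq_dec i r) as [->|Hne]; [now apply olt_ole|apply D3; lia].
Qed.

Lemma oadd_assoc a b c : oadd a (oadd b c) = oadd (oadd a b) c.
Proof.
  induction c as [|c IH|h IH]; cbn; [easy|now rewrite IH|].
  f_equal. apply functional_extensionality. exact IH.
Qed.

Lemma ole_oadd_r a b : ole a (oadd a b).
Proof.
  induction b as [|b IH|h IH]; cbn.
  - apply ole_refl.
  - apply ole_trans with (oadd a b); [easy|apply ole_succ].
  - apply ole_lub with 0. apply IH.
Qed.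

Lemma ole_oadd_l a b : ole b (oadd a b).
Proof.
  induction b as [|b IH|h IH]; cbn.
  - constructor.
  - constructor. now constructor.
  - constructor. intros n. apply ole_lub with n. apply IH.
Qed.

Lemma oadd_mono_r a :
  (forall b c, ole b c -> ole (oadd a b) (oadd a c)) /\
  (forall b c, olt b c -> olt (oadd a b) (oadd a c)).
Proof.
  apply (ole_olt_ind (fun b c _ => ole (oadd a b) (oadd a c))
                     (fun b c _ => olt (oadd a b) (oadd a c))).
  - intros. apply ole_oadd_r.
  - intros. cbn. now constructor.
  - intros. cbn. now constructor.
  - intros. cbn. now constructor.
  - intros b h n _ H. cbn. now apply olt_L with n.
Qed.

Lemma oadd_mono_l a a' b : ole a a' -> ole (oadd a b) (oadd a' b).
Proof.
  intros H. induction b as [|b IH|h IH]; cbn.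
  - easy.
  - constructor. now constructor.
  - constructor. intros n. apply ole_lub with n. apply IH.
Qed.

Lemma omuln_mono_l d d' n : ole d d' -> ole (omuln d n) (omuln d' n).
Proof.
  intros H. induction n as [|n IH]; cbn; [constructor|].
  apply ole_trans with (oadd (omuln d' n) d).
  - now apply oadd_mono_l.
  - now apply oadd_mono_r.
Qed.

Lemma omuln_mono_r d n m : n <= m -> ole (omuln d n) (omuln d m).
Proof.
  induction 1 as [|m _ IH]; [apply ole_refl|].
  apply ole_trans with (omuln d m); [easy|]. cbn. apply ole_oadd_r.
Qed.

(** * Powers of omega *)

Fixpoint opow_omega (x : Ord) : Ord :=
  match x with
  | OZ => OS OZ
  | OS x' => OL (omuln (opow_omega x'))
  | OL h => OL (fun n => opow_omega (h n))
  end.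

Lemma one_le_opow_omega x : ole (OS OZ) (opow_omega x).
Proof.
  induction x as [|x IH|h IH]; cbn.
  - apply ole_refl.
  - apply ole_lub with 1. cbn. apply ole_trans with (opow_omega x); [easy|].
    apply ole_oadd_l.
  - apply ole_lub with 0. apply IH.
Qed.

Lemma ole_opow_omega x : ole x (opow_omega x).
Proof.
  induction x as [|x IH|h IH]; cbn.
  - constructor.
  - apply ole_lub with 2. cbn. constructor.
    assert (K : olt x (oadd (opow_omega x) (OS OZ))) by (cbn; now constructor).
    eapply olt_ole_trans; [exact K|].
    apply ole_trans with (oadd (opow_omega x) (opow_omega x)).
    + apply oadd_mono_r. apply one_le_opow_omega.
    + apply oadd_mono_l. apply ole_oadd_l.
  - constructor. intros n. apply ole_lub with n. apply IH.
Qed.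

(** The leading term of the Cantor normal form: descending from a power above [b], the first power
    that is at most [b] has a finite multiple above [b]. *)
Lemma leading_power b :
  ole (OS OZ) b ->
  exists x n, ole (opow_omega x) b /\ olt b (omuln (opow_omega x) n).
Proof.
  intros H1.
  assert (H : forall x, olt b (opow_omega x) ->
    exists x n, ole (opow_omega x) b /\ olt b (omuln (opow_omega x) n)).
  { induction x as [|x IH|h IH]; cbn; intros H.
    - exfalso. apply (olt_irrefl b). now apply olt_ole_trans with (OS OZ).
    - apply olt_L_inv in H. destruct H as [n H].
      destruct (ole_or_olt (opow_omega x) b); eauto.
    - apply olt_L_inv in H. destruct H as [n H]. eauto. }
  (* [OS b] serves as the exponent because every ordinal is at most its power of omega. *)
  apply (H (OS b)).
  apply olt_ole_trans with (OS b); [constructor; apply ole_refl|].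
  apply ole_opow_omega.
Qed.

(** * Cylinders and compactness of Cantor space *)

Lemma choice_fun {A B : Type} (P : A -> B -> Prop) :
  (forall x, exists y, P x y) -> exists h, forall x, P x (h x).
Proof.
  intros H.
  exists (fun x => proj1_sig (constructive_indefinite_description _ (H x))).
  intros x. apply proj2_sig.
Qed.

Lemma agree_refl x n : agree x x n.
Proof. easy. Qed.

Lemma agree_sym x y n : agree x y n -> agree y x n.
Proof. intros H i Hi. symmetry. auto. Qed.

Lemma agree_trans x y z n : agree x y n -> agree y z n -> agree x z n.
Proof. intros H K i Hi. rewrite H by easy. auto. Qed.

Lemma agree_le x y n m : agree x y n -> m <= n -> agree x y m.
Proof. intros H K i Hi. apply H. lia. Qed.

(** Canonical representative of a cylinder: points of the same cylinder have equal truncations, so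
    choices can be made per cylinder. *)
Definition trunc (x : Cantor) (n : nat) : Cantor :=
  fun i => if i <? n then x i else false.

Lemma agree_trunc x n : agree (trunc x n) x n.
Proof.
  intros i Hi. unfold trunc. apply Nat.ltb_lt in Hi. now rewrite Hi.
Qed.

Lemma trunc_eq x y n : agree x y n -> trunc x n = trunc y n.
Proof.
  intros H. apply functional_extensionality. intros i. unfold trunc.
  destruct (Nat.ltb_spec i n); auto.
Qed.

Definition closed (F : Cantor -> Prop) : Prop :=
  forall x, (forall n, exists y, F y /\ agree x y n) -> F x.

Lemma closed_avoid F x :
  closed F -> ~ F x -> exists n, forall y, agree x y n -> ~ F y.
Proof.
  intros HF Hx. apply NNPP. intros K. apply Hx, HF. intros n.
  apply NNPP. intros L. apply K. exists n. intros y Hy Fy. eauto.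
Qed.

Lemma limit_of_nested (t : nat -> Cantor) (l : nat -> nat) :
  (forall j, agree (t j) (t (S j)) (l j)) -> (forall j, l j < l (S j)) ->
  exists x, forall j, agree (t j) x (l j).
Proof.
  intros Ht Hl.
  assert (Hj : forall j, j <= l j).
  { induction j as [|j IH]; [lia|]. specialize (Hl j). lia. }
  assert (Hll : forall d j, l j <= l (d + j)).
  { induction d as [|d IH]; intros j; [easy|]. cbn. specialize (Hl (d + j)).
    specialize (IH j). lia. }
  assert (Htt : forall d j, agree (t j) (t (d + j)) (l j)).
  { induction d as [|d IH]; intros j; [easy|].
    apply agree_trans with (t (d + j)); [apply IH|]. cbn.
    apply agree_le with (l (d + j)); [apply Ht|apply Hll]. }
  (* Coordinate [i] is fixed from stage [S i] on, because [S i <= l (S i)]. *)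
  exists (fun i => t (S i) i). intros j i Hi.
  destruct (Nat.le_ge_cases j (S i)) as [K|K].
  - replace (S i) with ((S i - j) + j) by lia. now apply Htt.
  - symmetry. replace j with ((j - S i) + S i) by lia. apply Htt.
    specialize (Hj (S i)). lia.
Qed.

(** König's argument: an initial segment met by every member of the chain extends by some bit. If
    each bit were refuted by a member, the smaller of the two members would miss both extensions. *)
Lemma compact_chain (F : nat -> Cantor -> Prop) :
  (forall n, closed (F n)) ->
  (forall n m, (forall x, F n x -> F m x) \/ (forall x, F m x -> F n x)) ->
  (forall n, exists x, F n x) -> exists x, forall n, F n x.
Proof.
  intros Hc Hch Hne.
  set (good := fun t j => forall n, exists x, F n x /\ agree t x j).
  (* The hypothesis [good] sits inside the existential so that choice yields a total function
     [T]. *)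
  assert (step : forall p : Cantor * nat, exists t', good (fst p) (snd p) ->
            agree (fst p) t' (snd p) /\ good t' (S (snd p))).
  { intros [t j]; cbn.
    set (upd := fun (b : bool) i => if i =? j then b else t i).
    assert (Hu : forall b, agree t (upd b) j).
    { intros b i Hi. unfold upd. destruct (Nat.eqb_spec i j); [lia|easy]. }
    assert (Hg : good t j -> exists b, good (upd b) (S j)).
    { intros G. apply NNPP. intros K.
      assert (K' : forall b, exists n, forall x, F n x -> ~ agree (upd b) x (S j)).
      { intros b. apply NNPP. intros L. apply K. exists b. intros n.
        apply NNPP. intros M. apply L. exists n. intros x Fx Ax. eauto. }
      destruct (choice_fun _ K') as [w Hw].
      assert (L : exists n, forall b x, F n x -> F (w b) x).
      { destruct (Hch (w true) (w false)) as [L|L].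
        - exists (w true). intros []; auto.
        - exists (w false). intros []; auto. }
      destruct L as [n L]. destruct (G n) as [x [Fx Ax]].
      apply (Hw (x j) x); [now apply L|]. intros i Hi. unfold upd.
      destruct (Nat.eqb_spec i j) as [->|]; [easy|]. apply Ax. lia. }
    destruct (classic (good t j)) as [G|G].
    - destruct (Hg G) as [b Gb]. exists (upd b). auto.
    - exists t. easy. }
  destruct (choice_fun _ step) as [T HT].
  set (t := fix t j := match j with 0 => fun _ => false | S j => T (t j, j) end).
  assert (G : forall j, good (t j) j).
  { induction j as [|j IH].
    - intros n. destruct (Hne n) as [x Fx]. exists x. split; [easy|]. intros i; lia.
    - apply (HT (t j, j)). exact IH. }
  destruct (limit_of_nested t (fun j => j)) as [x Hx].
  - intros j. apply (HT (t j, j)). apply G.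
  - lia.
  - exists x. intros n. apply Hc. intros j. destruct (G j n) as [y [Fy Ay]].
    exists y. split; [easy|]. apply agree_trans with (t j); [|easy].
    apply agree_sym, Hx.
Qed.

(* Output follows [y] as long as no good cylinder has been entered, and from the
   first good cylinder on follows the solution attached to that cylinder. *)
Lemma patch (y : Cantor) (G : Cantor -> nat -> Prop) (P : Cantor -> Cantor -> Prop) :
  (forall t x j, agree t x j -> G t j -> G x j) ->
  (forall t j, G t j -> exists k, cont_cantor k /\
     forall x, agree t x j -> agree y (k x) j /\ P x (k x)) ->
  exists k, cont_cantor k /\ (forall x, (forall j, ~ G x j) -> k x = y) /\
    (forall x j, G x j -> P x (k x)).
Proof.
  intros Ginv Hloc.
  assert (HK : forall p : Cantor * nat, exists k, G (fst p) (snd p) -> cont_cantor k /\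
     forall x, agree (fst p) x (snd p) -> agree y (k x) (snd p) /\ P x (k x)).
  { intros [t j]; cbn. destruct (classic (G t j)) as [H|H].
    - destruct (Hloc t j H) as [k Hk]. eauto.
    - exists (fun x => x). easy. }
  destruct (choice_fun _ HK) as [K K1]; clear HK.
  set (least := fun x j => G x j /\ forall i, i < j -> ~ G x i).
  assert (least_ex : forall x j, G x j -> exists i, least x i).
  { intros x j. induction j as [j IH] using (well_founded_induction Nat.lt_wf_0). intros H.
    destruct (classic (exists i, i < j /\ G x i)) as [[i [Hi Gi]]|N]; [eauto|].
    exists j. split; [easy|]. intros i Hi Gi. eauto. }
  assert (least_uniq : forall x i j, least x i -> least x j -> i = j).
  { intros x i j [A1 A2] [B1 B2]. destruct (Nat.lt_trichotomy i j) as [L|[L|L]]; [|easy|].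
    - now apply B2 in L.
    - now apply A2 in L. }
  assert (least_inv : forall x z j, agree x z j -> least x j -> least z j).
  { intros x z j A [B1 B2]. split; [eauto|]. intros i Hi Gi. apply (B2 i Hi).
    apply Ginv with z; [|easy]. apply agree_sym. apply agree_le with j; [easy|lia]. }
  assert (Hk : forall x, exists z,
     (exists j, least x j /\ z = K (trunc x j, j) x) \/ ((forall j, ~ G x j) /\ z = y)).
  { intros x. destruct (classic (exists j, G x j)) as [[j Gj]|N].
    - destruct (least_ex x j Gj) as [i Hi]. eauto 6.
    - exists y. right. split; [|easy]. intros j Gj. eauto. }
  destruct (choice_fun _ Hk) as [k k1]; clear Hk.
  assert (kleast : forall x j, least x j -> k x = K (trunc x j, j) x).
  { intros x j L. destruct (k1 x) as [[i [Hi ->]]|[N _]].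
    - now rewrite (least_uniq x i j).
    - exfalso. apply (N j), L. }
  assert (kbad : forall x, (forall j, ~ G x j) -> k x = y).
  { intros x N. destruct (k1 x) as [[j [[Gj _] _]]|[_ E]]; [|easy].
    exfalso. exact (N j Gj). }
  assert (Ktr : forall x j, G x j -> cont_cantor (K (trunc x j, j)) /\
     forall z, agree x z j -> agree y (K (trunc x j, j) z) j /\ P z (K (trunc x j, j) z)).
  { intros x j Gj. destruct (K1 (trunc x j, j)) as [C1 C2]; cbn in *.
    - apply Ginv with x; [|easy]. apply agree_sym, agree_trunc.
    - split; [easy|]. intros z A. apply C2. apply agree_trans with x; [|easy].
      apply agree_trunc. }
  exists k. split; [|split]; [|easy|].
  - intros x m. destruct (classic (exists j, G x j)) as [[j0 Gj0]|N].
    + destruct (least_ex x j0 Gj0) as [j L].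
      destruct (Ktr x j (proj1 L)) as [C1 _].
      destruct (C1 x m) as [n Hn]. exists (Nat.max n j). intros z A.
      assert (Aj : agree x z j) by (apply agree_le with (Nat.max n j); [easy|lia]).
      rewrite (kleast x j L), (kleast z j) by eauto.
      rewrite <- (trunc_eq x z j Aj). apply Hn.
      apply agree_le with (Nat.max n j); [easy|lia].
    + assert (N' : forall j, ~ G x j) by eauto. rewrite (kbad x N').
      exists m. intros z A.
      (* A good cylinder of [z] of length at most [m] would be one of [x]. So a switch happens only
         beyond [m], and the new output still agrees with [y] up to [m]. *)
      destruct (classic (exists j, G z j)) as [[j0 Gj0]|M].
      * destruct (least_ex z j0 Gj0) as [j L]. rewrite (kleast z j L).
        destruct (Nat.le_gt_cases j m) as [D|D].
        -- exfalso. apply (N' j). apply Ginv with z; [|apply L].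
           apply agree_sym. now apply agree_le with m.
        -- apply agree_le with j; [|lia]. now apply (Ktr z j (proj1 L)).
      * rewrite kbad by eauto. apply agree_refl.
  - intros x j Gj. destruct (least_ex x j Gj) as [i L].
    rewrite (kleast x i L). apply (Ktr x i (proj1 L)). apply agree_refl.
Qed.

(** * Derivations *)

(** Cylinders form a base, and the two sets of [fam] are the sets where a fixed bit is a correct
    answer. So a point survives exactly when neither bit works on any cylinder around it. *)
Lemma derive_fam f p e (P : Cantor -> Prop) x :
  derive (fam f p e) P x <->
  P x /\ forall b n, exists y, P y /\ agree x y n /\ ~ correct b (f y) p e.
Proof.
  split.
  - intros [Px H]. split; [exact Px|]. intros b n. apply NNPP. intros K. apply H.
    exists (fun y => agree x y n). split; [|split].
    + intros z Az. exists n. intros y Ay. now apply agree_trans with z.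
    + apply agree_refl.
    + assert (K' : forall y, P y -> agree x y n -> correct b (f y) p e).
      { intros y Py Ay. apply NNPP. intros L. eauto. }
      destruct b; eexists.
      * split; [left; reflexivity|]. intros y Py Ay.
        now destruct (K' y Py Ay) as [[_ L]|[E _]].
      * split; [right; reflexivity|]. intros y Py Ay.
        now destruct (K' y Py Ay) as [[E _]|[_ L]].
  - intros [Px H]. split; [exact Px|]. intros [U [Uo [Ux [C [HC HU]]]]].
    destruct (Uo x Ux) as [n Hn].
    destruct HC as [->| ->].
    + destruct (H true n) as [y [Py [Ay L]]]. apply L. left. split; [easy|].
      apply (HU y); auto.
    + destruct (H false n) as [y [Py [Ay L]]]. apply L. right. split; [easy|].
      apply (HU y); auto.
Qed.

Lemma not_derive_fam f p e (P : Cantor -> Prop) x :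
  P x -> ~ derive (fam f p e) P x ->
  exists b n, forall y, P y -> agree x y n -> correct b (f y) p e.
Proof.
  intros Px H. apply NNPP. intros K. apply H. apply derive_fam. split; [easy|].
  intros b n. apply NNPP. intros L. apply K. exists b, n. intros y Py Ay.
  apply NNPP. intros M. eauto.
Qed.

Lemma derive_mono f p e (P P' : Cantor -> Prop) :
  (forall x, P x -> P' x) ->
  forall x, derive (fam f p e) P x -> derive (fam f p e) P' x.
Proof.
  intros H x. rewrite !derive_fam. intros [Px K]. split; [auto|].
  intros b n. destruct (K b n) as [y [Py L]]. eauto.
Qed.

Lemma deriv_seq_mono f p e :
  (forall a b, ole a b -> forall x, deriv_seq (fam f p e) b x -> deriv_seq (fam f p e) a x) /\
  (forall a b, olt a b -> forall x, deriv_seq (fam f p e) b x -> deriv_seq (fam f p e) (OS a) x).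
Proof.
  apply (ole_olt_ind
    (fun a b _ => forall x, deriv_seq (fam f p e) b x -> deriv_seq (fam f p e) a x)
    (fun a b _ => forall x, deriv_seq (fam f p e) b x -> deriv_seq (fam f p e) (OS a) x)).
  - easy.
  - auto.
  - intros h b _ IH x H n. auto.
  - intros a b _ IH x. exact (derive_mono f p e _ _ IH x).
  - intros a h n _ IH x H. apply IH. apply H.
Qed.

Lemma deriv_seq_anti f p e a b x :
  ole a b -> deriv_seq (fam f p e) b x -> deriv_seq (fam f p e) a x.
Proof. intros H. exact (proj1 (deriv_seq_mono f p e) a b H x). Qed.

Lemma deriv_seq_closed f p e a : closed (deriv_seq (fam f p e) a).
Proof.
  induction a as [|a IH|h IH]; intros x H.
  - easy.
  - cbn. apply derive_fam. split.
    + apply IH. intros n. destruct (H n) as [y [Hy A]]. exists y.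
      split; [apply Hy|easy].
    + intros b n. destruct (H n) as [y [Hy A]]. cbn in Hy.
      apply derive_fam in Hy. destruct Hy as [_ Hy].
      destruct (Hy b n) as [z [Pz [Az Cz]]]. exists z.
      split; [easy|split; [|easy]]. now apply agree_trans with y.
  - intros n. apply IH. intros m. destruct (H m) as [y [Hy A]]. eauto.
Qed.

(* [alpha] is always a successor, by compactness. *)
Lemma deriv_seq_empty_succ f p e a :
  (forall x, ~ deriv_seq (fam f p e) a x) ->
  exists c, ole (OS c) a /\ forall x, ~ deriv_seq (fam f p e) (OS c) x.
Proof.
  induction a as [|a IH|h IH]; intros H.
  - exfalso. apply (H (fun _ => true)). exact I.
  - exists a. split; [apply ole_refl|easy].
  - assert (K : exists n, forall x, ~ deriv_seq (fam f p e) (h n) x).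
    (* Otherwise the stages [h n] form a chain of nonempty closed sets, and a common point would lie
       in the limit stage. *)
    { apply NNPP. intros K.
      destruct (compact_chain (fun n => deriv_seq (fam f p e) (h n))) as [x Hx].
      - intros n. apply deriv_seq_closed.
      - intros n m. destruct (ole_or_olt (h n) (h m)) as [L|L].
        + right. intros x. now apply deriv_seq_anti.
        + left. intros x. apply deriv_seq_anti. now apply olt_ole.
      - intros n. apply NNPP. intros L. apply K. exists n. intros x Hx. eauto.
      - exact (H x Hx). }
    destruct K as [n K]. destruct (IH n K) as [c [C1 C2]]. exists c.
    split; [|easy]. now apply ole_lub with n.
Qed.

(** * Existence of the rank *)

(** Makes the cylinders countable: a prefix of length [j] is coded by the binary digits of a
    number. *)
Lemma binary_code (j : nat) (x : Cantor) : exists c, agree x (Nat.testbit c) j.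
Proof.
  revert x; induction j as [|j IH]; intros x.
  - exists 0. intros i; lia.
  - destruct (IH (fun i => x (S i))) as [c Hc].
    exists (2 * c + Nat.b2n (x 0)). intros [|i] Hi.
    + now rewrite Nat.testbit_0_r.
    + rewrite Nat.testbit_succ_r. apply (Hc i). lia.
Qed.

(** For each of the countably many cylinders that is ever cleared, take a stage at which it is; let
    [a] be the supremum. A point lost right after [a] loses a whole cylinder, which was then cleared
    by stage [a] already. *)
Lemma deriv_seq_stabilizes f p e : exists a, forall x,
  deriv_seq (fam f p e) a x -> derive (fam f p e) (deriv_seq (fam f p e) a) x.
Proof.
  assert (H : forall s : nat * nat, exists a,
    (exists a', forall x, agree (Nat.testbit (fst s)) x (snd s) -> ~ deriv_seq (fam f p e) a' x) ->
    forall x, agree (Nat.testbit (fst s)) x (snd s) -> ~ deriv_seq (fam f p e) a x).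
  { intros s. destruct (classic (exists a', forall x,
      agree (Nat.testbit (fst s)) x (snd s) -> ~ deriv_seq (fam f p e) a' x)) as [[a Ha]|N].
    - eauto.
    - exists OZ. easy. }
  destruct (choice_fun _ H) as [w Hw].
  exists (OL (fun j => OL (fun c => w (c, j)))). intros x Hx. apply NNPP. intros K.
  set (a := OL (fun j => OL (fun c => w (c, j)))) in *.
  destruct (not_derive_fam _ _ _ _ _ Hx K) as [b [j Hj]].
  destruct (binary_code j x) as [c Hc].
  apply (Hw (c, j)) with x; cbn; [|now apply agree_sym|exact (Hx j c)].
  exists (OS a). intros z Az Hz. cbn [deriv_seq] in Hz. apply derive_fam in Hz.
  destruct Hz as [Pz Hz]. destruct (Hz b j) as [y [Py [Ay Cy]]]. apply Cy.
  apply Hj; [easy|]. apply agree_trans with z; [|easy].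
  now apply agree_trans with (Nat.testbit c).
Qed.

Open Scope R_scope.

Lemma Q2R_pos e : (0 < e)%Q -> 0 < Q2R e.
Proof. intros H. apply Qlt_Rlt in H. now rewrite RMicromega.Q2R_0 in H. Qed.

Lemma not_correct_true y p e : ~ correct true y p e <-> Q2R p + Q2R e <= y.
Proof.
  unfold correct. split.
  - intros H. destruct (Rle_lt_dec (Q2R p + Q2R e) y); [easy|]. exfalso; auto.
  - intros H [[_ K]|[K _]]; [lra|easy].
Qed.

Lemma not_correct_false y p e : ~ correct false y p e <-> y <= Q2R p - Q2R e.
Proof.
  unfold correct. split.
  - intros H. destruct (Rle_lt_dec y (Q2R p - Q2R e)); [easy|]. exfalso; auto.
  - intros H [[K _]|[_ K]]; [easy|lra].
Qed.

(* If the derivation never reached the empty set, a Baire category construction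
   inside its stable part would produce a point where the approximations to [f]
   oscillate between above [p + e/2] and below [p - e/2]. *)
Lemma deriv_seq_vanishes f p e :
  Baire1 f -> (0 < e)%Q -> exists a, forall x, ~ deriv_seq (fam f p e) a x.
Proof.
  intros [fs [fc flim]] He. apply Q2R_pos in He.
  destruct (deriv_seq_stabilizes f p e) as [a Ha]. exists a. intros x0 Hx0.
  set (P := deriv_seq (fam f p e) a) in *.
  (* Where bit [b] is wrong, [f] is at least [e] away from [p]. Convergence and continuity cost
     [e/4] each, which leaves [e/2]. *)
  assert (step1 : forall b t l N, P t -> exists t' l', P t' /\ (l < l')%nat /\ agree t t' l /\
     exists n, (N <= n)%nat /\ forall z, agree t' z l' ->
       if b : bool then fs n z > Q2R p + Q2R e / 2 else fs n z < Q2R p - Q2R e / 2).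
  { intros b t l N Pt. apply Ha in Pt. apply derive_fam in Pt. destruct Pt as [_ Pt].
    destruct (Pt b l) as [t' [Pt' [At Ct]]].
    destruct (flim t' (Q2R e / 4)) as [M HM]; [lra|].
    specialize (HM (Nat.max N M) ltac:(lia)). unfold Rdist in HM.
    destruct (fc (Nat.max N M) t' (Q2R e / 4)) as [l' Hl']; [lra|].
    exists t', (Nat.max (S l) l'). repeat split; try easy; [lia|].
    exists (Nat.max N M). split; [lia|]. intros z Az.
    specialize (Hl' z ltac:(apply agree_le with (Nat.max (S l) l'); [easy|lia])).
    apply Rabs_def2 in HM. apply Rabs_def2 in Hl'. destruct b.
    - apply not_correct_true in Ct. lra.
    - apply not_correct_false in Ct. lra. }
  assert (step : forall s : (Cantor * nat) * nat, exists s' : Cantor * nat,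
     P (fst (fst s)) -> P (fst s') /\ (snd (fst s) < snd s')%nat /\
     agree (fst (fst s)) (fst s') (snd (fst s)) /\
     forall b : bool, exists n, (snd s <= n)%nat /\ forall z, agree (fst s') z (snd s') ->
       if b then fs n z > Q2R p + Q2R e / 2 else fs n z < Q2R p - Q2R e / 2).
  { intros [[t l] N]; cbn. destruct (classic (P t)) as [Pt|Pt]; [|exists (t, l); easy].
    destruct (step1 true t l N Pt) as [t1 [l1 [P1 [L1 [A1 [n1 [N1 F1]]]]]]].
    destruct (step1 false t1 l1 N P1) as [t2 [l2 [P2 [L2 [A2 [n2 [N2 F2]]]]]]].
    exists (t2, l2). intros _; cbn. repeat split; try easy; [lia| |].
    - apply agree_trans with t1; [easy|]. apply agree_le with l1; [easy|lia].
    - intros [].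
      + exists n1. split; [easy|]. intros z Az. apply F1.
        apply agree_trans with t2; [easy|]. apply agree_le with l2; [easy|lia].
      + exists n2. split; [easy|]. exact F2. }
  destruct (choice_fun _ step) as [T HT].
  set (s := fix s j := match j with O => (x0, O) | S j => T (s j, j) end).
  assert (Ps : forall j, P (fst (s j))).
  { induction j as [|j IH]; [exact Hx0|]. apply (HT (s j, j)). exact IH. }
  destruct (limit_of_nested (fun j => fst (s j)) (fun j => snd (s j))) as [x Hx].
  - intros j. apply (HT (s j, j)). apply Ps.
  - intros j. apply (HT (s j, j)). apply Ps.
  (* Beyond [M] two approximations at [x] differ by less than [e], but the construction supplies two
     that differ by more. *)
  - destruct (flim x (Q2R e / 2)) as [M HM]; [lra|].
    destruct (HT (s M, M) (Ps M)) as [_ [_ [_ F]]]. cbn [fst snd] in F.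
    destruct (F true) as [n1 [N1 F1]]. destruct (F false) as [n2 [N2 F2]].
    specialize (F1 x (Hx (S M))). specialize (F2 x (Hx (S M))). cbn in F1, F2.
    assert (G1 := HM n1 N1). assert (G2 := HM n2 N2). unfold Rdist in *.
    apply Rabs_def2 in G1. apply Rabs_def2 in G2. lra.
Qed.

(** The least vanishing stage exists and is a successor, which turns the rank's weak bound into a
    [c] strictly below the rank, as [ocoarse] requires. *)
Lemma brank_bound f p e a :
  Baire1 f -> (0 < e)%Q -> is_brank f a ->
  exists c, olt c a /\ forall x, ~ deriv_seq (fam f p e) (OS c) x.
Proof.
  intros Hf He [Ha _].
  destruct (least_ord _ (deriv_seq_vanishes f p e Hf He)) as [d [D1 D2]].
  destruct (deriv_seq_empty_succ f p e d D1) as [c [C1 C2]].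
  exists c. split; [|easy]. apply ole_S_inv. apply ole_trans with d; [easy|].
  exact (Ha p e d He (conj D1 D2)).
Qed.

Lemma brank_lower f a d :
  is_brank f a -> olt d a ->
  exists p e x, (0 < e)%Q /\ deriv_seq (fam f p e) d x.
Proof.
  intros [_ Ha] Hd. apply NNPP. intros K. apply (olt_irrefl d).
  apply olt_ole_trans with a; [easy|]. apply Ha. intros p e c He [_ Hc].
  apply Hc. intros x Hx. apply K. eauto 6.
Qed.

(** * From a reduction to a bound on the rank *)

(** The derivation with a free starting set, here intersections of preimages of stages for [g]. *)
Fixpoint derived_from (CC : (Cantor -> Prop) -> Prop) (S0 : Cantor -> Prop) (nu : Ord)
    : Cantor -> Prop :=
  match nu with
  | OZ => S0
  | OS nu' => derive CC (derived_from CC S0 nu')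
  | OL h => fun x => forall n, derived_from CC S0 (h n) x
  end.

Lemma deriv_seq_derived_from f p e (S0 : Cantor -> Prop) nu :
  (forall x, S0 x) ->
  forall x, deriv_seq (fam f p e) nu x -> derived_from (fam f p e) S0 nu x.
Proof.
  intros HS. induction nu as [|nu IH|h IH]; intros x H.
  - apply HS.
  - exact (derive_mono f p e _ _ IH x H).
  - intros n. apply IH. apply H.
Qed.

(** Whether a point survives depends only on the starting set near it: witnesses can be sought at
    depth [Nat.max n m], inside the cylinder. *)
Lemma derived_from_local f p e (S0 S1 : Cantor -> Prop) x n nu :
  (forall y, agree x y n -> S0 y -> S1 y) ->
  forall y, agree x y n ->
    derived_from (fam f p e) S0 nu y -> derived_from (fam f p e) S1 nu y.
Proof.
  intros HS. induction nu as [|nu IH|h IH]; intros y Ay; cbn.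
  - now apply HS.
  - rewrite !derive_fam. intros [Dy H]. split; [now apply IH|].
    intros b m. destruct (H b (Nat.max n m)) as [z [Dz [Az Cz]]]. exists z. split.
    + apply IH; [|easy]. apply agree_trans with y; [easy|].
      apply agree_le with (Nat.max n m); [easy|lia].
    + split; [|easy]. apply agree_le with (Nat.max n m); [easy|lia].
  - intros H m. now apply IH.
Qed.

Lemma derived_from_mono f p e (S0 S1 : Cantor -> Prop) nu :
  (forall y, S0 y -> S1 y) -> forall y,
    derived_from (fam f p e) S0 nu y -> derived_from (fam f p e) S1 nu y.
Proof.
  intros H y. apply derived_from_local with (x := y) (n := O); [auto|apply agree_refl].
Qed.

Lemma derived_from_add f p e S0 a b x :
  derived_from (fam f p e) S0 (oadd a b) x ->
  derived_from (fam f p e) (derived_from (fam f p e) S0 a) b x.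
Proof.
  revert x; induction b as [|b IH|h IH]; intros x H; cbn in *.
  - easy.
  - exact (derive_mono f p e _ _ IH x H).
  - intros n. apply IH. apply H.
Qed.

Lemma derived_from_sub f p e S0 nu x :
  derived_from (fam f p e) S0 nu x -> S0 x.
Proof.
  revert x; induction nu as [|nu IH|h IH]; intros x H.
  - easy.
  - apply IH. apply H.
  - exact (IH O x (H O)).
Qed.

(** * Multiplicities and the covering property *)

Fixpoint nsum (n : nat -> nat) (r : nat) : nat :=
  match r with O => O | S r' => (nsum n r' + n r')%nat end.

Lemma nsum_le n m r :
  (forall i, (i < r)%nat -> (n i <= m i)%nat) -> (nsum n r <= nsum m r)%nat.
Proof.
  induction r as [|r IH]; intros H; cbn; [lia|].
  specialize (IH ltac:(intros; apply H; lia)). specialize (H r ltac:(lia)). lia.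
Qed.

Lemma nsum_squeeze n m r :
  (forall i, (i < r)%nat -> (n i <= m i)%nat) -> (nsum m r <= nsum n r)%nat ->
  forall i, (i < r)%nat -> n i = m i.
Proof.
  induction r as [|r IH]; intros H L i Hi; cbn in *; [lia|].
  assert (K := nsum_le n m r ltac:(intros; apply H; lia)).
  assert (H' := H r ltac:(lia)).
  destruct (Nat.eq_dec i r) as [->|Hne]; [lia|].
  apply IH; [intros; apply H; lia|lia|lia].
Qed.

Lemma le_nsum n r i : (i < r)%nat -> (n i <= nsum n r)%nat.
Proof.
  induction r as [|r IH]; intros H; cbn; [lia|].
  destruct (Nat.eq_dec i r) as [->|Hne]; [lia|]. specialize (IH ltac:(lia)). lia.
Qed.

Lemma nsum_pigeonhole n r c :
  (r * c < nsum n r)%nat -> exists i, (i < r)%nat /\ (c < n i)%nat.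
Proof.
  induction r as [|r IH]; intros H; cbn in H; [lia|].
  destruct (Nat.lt_ge_cases c (n r)) as [K|K]; [exists r; lia|].
  destruct IH as [i [Hi L]]; [lia|]. exists i. lia.
Qed.

(** In the application [V i a] is the preimage under [k i] of stage [a] for the question [i].
    Quantifying over all starting stages [nu] allows iteration. *)
Definition covers (f : Cantor -> R) (p e : Q) (r : nat) (V : nat -> Ord -> Cantor -> Prop)
    (c : Ord) : Prop :=
  forall nu x,
    derived_from (fam f p e) (fun z => forall i, (i < r)%nat -> V i (nu i) z) c x ->
    exists i, (i < r)%nat /\ V i (oadd (nu i) c) x.

(** [n i] counts the blocks of length [c] gained by question [i]; only the total is bounded from
    below. *)
Definition level_set (r : nat) (V : nat -> Ord -> Cantor -> Prop) (c : Ord)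
    (nu : nat -> Ord) (m : nat) (x : Cantor) : Prop :=
  exists n, (m <= nsum n r)%nat /\
    forall i, (i < r)%nat -> V i (oadd (nu i) (omuln c (n i))) x.

(** If the total cannot be raised at [x], each question has a maximal multiplicity there and these
    sum to [m]. By closedness no larger multiplicity occurs near [x], so locally the level set lies
    in a single intersection of stages. Covering then gains one more block, a contradiction. *)
Lemma level_set_step f p e r V c nu m x :
  (forall i a, closed (V i a)) ->
  (forall i a b z, ole a b -> V i b z -> V i a z) ->
  covers f p e r V c ->
  derived_from (fam f p e) (level_set r V c nu m) c x ->
  level_set r V c nu (S m) x.
Proof.
  intros Vc Va Hcov Hx. assert (Hx0 := derived_from_sub _ _ _ _ _ _ Hx).
  assert (Hbase : forall i, (i < r)%nat -> V i (nu i) x).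
  { destruct Hx0 as [n [_ Hz]]. intros i Hi.
    apply Va with (oadd (nu i) (omuln c (n i))); [apply ole_oadd_r|auto]. }
  apply NNPP. intros N.
  assert (Hex : forall i, exists n, (i < r)%nat ->
     V i (oadd (nu i) (omuln c n)) x /\ ~ V i (oadd (nu i) (omuln c (S n))) x).
  { intros i. apply NNPP. intros K.
    assert (Hi : (i < r)%nat).
    { apply NNPP. intros L. apply K. exists O. intros; lia. }
    assert (all : forall n, V i (oadd (nu i) (omuln c n)) x).
    { induction n as [|n IH]; [now apply Hbase|]. apply NNPP. intros L.
      apply K. exists n. auto. }
    apply N. exists (fun i' => if Nat.eqb i' i then S m else O). split.
    - assert (L := le_nsum (fun i' => if Nat.eqb i' i then S m else O) r i Hi).
      cbn in L. now rewrite Nat.eqb_refl in L.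
    - intros i' Hi'. destruct (Nat.eqb_spec i' i) as [->|]; [apply all|].
      now apply Hbase. }
  destruct (choice_fun _ Hex) as [n Hn]; clear Hex.
  assert (Hmax : forall i z w, (i < r)%nat -> ~ V i (oadd (nu i) (omuln c (S (n i)))) z ->
     V i (oadd (nu i) (omuln c w)) z -> (w <= n i)%nat).
  { intros i z w Hi Nz Vz. apply NNPP. intros L. apply Nz.
    eapply Va; [|exact Vz]. apply oadd_mono_r. apply omuln_mono_r. lia. }
  assert (Hsum : nsum n r = m).
  { destruct Hx0 as [w [W1 W2]].
    assert (nsum w r <= nsum n r)%nat.
    { apply nsum_le. intros i Hi. apply (Hmax i x); [easy|now apply Hn|auto]. }
    assert (~ (S m <= nsum n r)%nat); [|lia].
    intros L. apply N. exists n. split; [easy|]. intros i Hi. now apply Hn. }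
  assert (Hnb : forall i, exists l, (i < r)%nat -> forall z, agree x z l ->
     ~ V i (oadd (nu i) (omuln c (S (n i)))) z).
  { intros i. destruct (classic (i < r)%nat) as [Hi|Hi]; [|exists O; easy].
    destruct (closed_avoid _ x (Vc i _) (proj2 (Hn i Hi))) as [l Hl]. exists l. auto. }
  destruct (choice_fun _ Hnb) as [l Hl].
  (* Near [x] any admissible vector is pointwise at most [n] and has at least the same sum, so it
     equals [n]. *)
  assert (Hloc : forall z, agree x z (nsum l r) -> level_set r V c nu m z ->
     forall i, (i < r)%nat -> V i (oadd (nu i) (omuln c (n i))) z).
  { intros z Az [w [W1 W2]] i Hi.
    rewrite <- (nsum_squeeze w n r); [now apply W2| |lia|easy].
    intros j Hj. apply (Hmax j z); [easy| |now apply W2].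
    apply Hl; [easy|]. apply agree_le with (nsum l r); [easy|now apply le_nsum]. }
  destruct (Hcov (fun i => oadd (nu i) (omuln c (n i))) x) as [i [Hi Vi]].
  - revert Hx. apply derived_from_local with (x := x) (n := nsum l r); [easy|].
    apply agree_refl.
  - apply (Hn i Hi). cbn. now rewrite oadd_assoc.
Qed.

Lemma derived_from_level_set f p e r V c nu m x :
  (forall i a, closed (V i a)) ->
  (forall i a b z, ole a b -> V i b z -> V i a z) ->
  covers f p e r V c ->
  derived_from (fam f p e) (fun z => forall i, (i < r)%nat -> V i (nu i) z) (omuln c m) x ->
  level_set r V c nu m x.
Proof.
  intros Vc Va Hcov. revert x. induction m as [|m IH]; intros x Hx.
  - exists (fun _ => O). split; [lia|]. exact Hx.
  - cbn in Hx. apply derived_from_add in Hx.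
    apply (level_set_step f p e); try easy.
    exact (derived_from_mono f p e _ _ c IH x Hx).
Qed.

(** The index may vary with [n], but there are only [r] of them: if each [i] failed at some
    [h (w i)], the index found at the largest of these stages would contradict its own failure. *)
Lemma covers_limit f p e r V h :
  (forall i a b z, ole a b -> V i b z -> V i a z) ->
  (forall i k, V i (OL k) = (fun z => forall n, V i (k n) z)) ->
  (forall nu x,
    derived_from (fam f p e) (fun z => forall i, (i < r)%nat -> V i (nu i) z) (OL h) x ->
    forall n, exists i, (i < r)%nat /\ V i (oadd (nu i) (h n)) x) ->
  covers f p e r V (OL h).
Proof.
  intros Va VL H nu x Hx. apply NNPP. intros N.
  assert (K : forall i, exists n, (i < r)%nat -> ~ V i (oadd (nu i) (h n)) x).
  { intros i. apply NNPP. intros K.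
    assert (Hi : (i < r)%nat).
    { apply NNPP. intros L. apply K. exists O. easy. }
    apply N. exists i. split; [easy|]. cbn. rewrite VL. intros n. apply NNPP. intros L.
    apply K. exists n. auto. }
  destruct (choice_fun _ K) as [w Hw].
  destruct (finite_max_index h r w) as [n Hn].
  destruct (H nu x Hx n) as [i [Hi Vi]]. apply (Hw i Hi).
  apply Va with (oadd (nu i) (h n)); [|easy]. apply oadd_mono_r. auto.
Qed.

Lemma covers_opow_omega f p e r V y :
  (forall i a, closed (V i a)) ->
  (forall i a b z, ole a b -> V i b z -> V i a z) ->
  (forall i k, V i (OL k) = (fun z => forall n, V i (k n) z)) ->
  covers f p e r V (OS OZ) ->
  covers f p e r V (opow_omega y).
Proof.
  intros Vc Va VL H1. induction y as [|y IH|h IH]; cbn [opow_omega].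
  - easy.
  - apply covers_limit; [easy|easy|]. intros nu x Hx n.
    (* A total above [r * n] gives one of the [r] questions more than [n] blocks. *)
    assert (L := derived_from_level_set f p e r V _ nu (S (r * n)) x Vc Va IH (Hx _)).
    destruct L as [w [W1 W2]]. destruct (nsum_pigeonhole w r n) as [i [Hi Hl]]; [lia|].
    exists i. split; [easy|]. eapply Va; [|exact (W2 i Hi)].
    apply oadd_mono_r. apply omuln_mono_r. lia.
  - apply covers_limit; [easy|easy|]. intros nu x Hx n. apply IH. apply Hx.
Qed.

Lemma nth_map_seq (F : nat -> bool) r i d :
  (i < r)%nat -> nth i (map F (seq 0 r)) d = F i.
Proof.
  intros H. rewrite (nth_indep _ d (F O)) by now rewrite length_map, length_seq.
  rewrite map_nth, seq_nth by easy. easy.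
Qed.

(** If no question's stage survives at [x], each question has a constant correct answer near [x] on
    its stage. Feeding these bits to [h] gives one correct answer for [f] near [x], so [x] does not
    survive for [f] either. *)
Lemma covers_of_reduction f g p e r q dl k h :
  (forall i, (i < r)%nat -> cont_cantor (k i)) ->
  (forall (A : Cantor) (sigma : list bool), length sigma = r ->
     (forall i, (i < r)%nat -> correct (nth i sigma false) (g (k i A)) (q i) (dl i)) ->
     correct (h sigma) (f A) p e) ->
  covers f p e r (fun i a x => (i < r)%nat -> deriv_seq (fam g (q i) (dl i)) a (k i x)) (OS OZ).
Proof.
  intros Hk Hh nu x Hx. cbn in Hx. apply NNPP. intros N.
  apply derive_fam in Hx. destruct Hx as [Qx Hx].
  assert (HB : forall i, exists B : bool * nat, (i < r)%nat -> forall z, agree x z (snd B) ->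
     deriv_seq (fam g (q i) (dl i)) (nu i) (k i z) ->
     correct (fst B) (g (k i z)) (q i) (dl i)).
  { intros i. destruct (classic (i < r)%nat) as [Hi|Hi]; [|exists (true, O); easy].
    destruct (not_derive_fam g (q i) (dl i) (deriv_seq (fam g (q i) (dl i)) (nu i)) (k i x))
      as [b [n Hn]].
    - now apply Qx.
    - intros D. apply N. exists i. split; [easy|]. intros _. exact D.
    - destruct (Hk i Hi x n) as [m Hm]. exists (b, m). intros _ z Az Dz. cbn in *.
      apply Hn; auto. }
  destruct (choice_fun _ HB) as [B HB'].
  destruct (Hx (h (map (fun i => fst (B i)) (seq 0 r))) (nsum (fun i => snd (B i)) r))
    as [z [Qz [Az Cz]]].
  apply Cz. apply Hh.
  - now rewrite length_map, length_seq.
  - intros i Hi. rewrite nth_map_seq by easy. apply HB'; [easy| |now apply Qz].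
    eapply agree_le; [exact Az|]. exact (le_nsum (fun i => snd (B i)) r i Hi).
Qed.

(** * Discontinuity *)

Lemma rational_window x y :
  x < y -> exists q d, (0 < d)%Q /\ x <= Q2R q - Q2R d /\ Q2R q + Q2R d <= y.
Proof.
  intros H. set (N := Z.to_pos (up (3 / (y - x)))).
  assert (H3 : 0 < 3 / (y - x)) by (apply Rdiv_lt_0_compat; lra).
  assert (HN : 3 / (y - x) < IZR (Zpos N)).
  { destruct (archimed (3 / (y - x))) as [A _]. unfold N. rewrite Z2Pos.id; [lra|].
    apply lt_IZR. lra. }
  set (n := IZR (Zpos N)) in *.
  assert (Hn : 0 < n) by lra.
  assert (Hn' : 3 * / n < y - x).
  { apply Rmult_lt_reg_r with n; [easy|]. rewrite Rmult_assoc, Rinv_l by lra.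
    apply Rmult_lt_compat_r with (r := y - x) in HN; [|lra].
    unfold Rdiv in HN. rewrite Rmult_assoc, Rinv_l in HN by lra. lra. }
  destruct (archimed (n * x)) as [A1 A2].
  assert (Hi : 0 < / n) by now apply Rinv_0_lt_compat.
  assert (Hx : x = n * x * / n) by (field; lra).
  (* On the grid of mesh [1/n], with [3/n < y - x], the first point above [x] and the next two lie
     in the interval; the middle one is the centre. *)
  exists ((up (n * x) + 1)%Z # N)%Q, (1 # N)%Q. split; [reflexivity|].
  unfold Q2R; cbn [Qnum Qden]. fold n. rewrite plus_IZR.
  generalize dependent (IZR (up (n * x))). intros u A1 A2.
  assert (B1 : n * x * / n <= u * / n) by (apply Rmult_le_compat_r; lra).
  assert (B2 : u * / n <= (n * x + 1) * / n) by (apply Rmult_le_compat_r; lra).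
  rewrite !Rmult_plus_distr_r in *. rewrite <- Hx in *. lra.
Qed.

(* For [0 < d], [~ correct b v q d] says that [negb b] is the only correct answer. *)
Lemma discontinuity_question g :
  ~ Baire0 g -> exists y q d pol, (0 < d)%Q /\ ~ correct (negb pol) (g y) q d /\
    forall n, exists z, agree y z n /\ ~ correct pol (g z) q d.
Proof.
  intros H.
  assert (K : exists y eps, 0 < eps /\
    forall n, exists z, agree y z n /\ eps <= Rabs (g y - g z)).
  { apply NNPP. intros K. apply H. intros y eps He. apply NNPP. intros L. apply K.
    exists y, eps. split; [easy|]. intros n. apply NNPP. intros M. apply L.
    exists n. intros z Az. apply Rnot_le_lt. intros O'. eauto. }
  destruct K as [y [eps [He K]]].
  (* Either upward jumps occur arbitrarily close to [y], or all jumps close enough go downward. *)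
  destruct (classic (forall n, exists z, agree y z n /\ g y + eps <= g z)) as [U|U].
  - destruct (rational_window (g y) (g y + eps)) as [q [d [Hd [W1 W2]]]]; [lra|].
    exists y, q, d, true. split; [easy|]. split; [now apply not_correct_false|].
    intros n. destruct (U n) as [z [Az Gz]]. exists z. split; [easy|].
    apply not_correct_true. lra.
  - destruct (rational_window (g y - eps) (g y)) as [q [d [Hd [W1 W2]]]]; [lra|].
    exists y, q, d, false. split; [easy|]. split; [now apply not_correct_true|].
    intros n. apply not_all_ex_not in U. destruct U as [n0 U].
    destruct (K (Nat.max n n0)) as [z [Az Gz]]. exists z.
    split; [apply agree_le with (Nat.max n n0); [easy|lia]|].
    apply not_correct_false.
    assert (~ (g y + eps <= g z)).
    { intros L. apply U. exists z. split; [|easy].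
      apply agree_le with (Nat.max n n0); [easy|lia]. }
    unfold Rabs in Gz. destruct (Rcase_abs (g y - g z)); lra.
Qed.

(** A point of discontinuity survives one derivation: one bit fails at the point itself, the other
    arbitrarily close to it. *)
Lemma one_lt_brank g b : Baire1 g -> ~ Baire0 g -> is_brank g b -> olt (OS OZ) b.
Proof.
  intros H1 H0 Hb.
  destruct (discontinuity_question g H0) as [y [q [d [pol [Hd [Hy Hz]]]]]].
  destruct (brank_bound g q d b H1 Hd Hb) as [c [C1 C2]].
  apply olt_ole_trans with (OS c); [|now constructor]. constructor.
  destruct (ole_or_olt (OS OZ) c) as [L|L]; [easy|]. exfalso.
  apply (C2 y). apply deriv_seq_anti with (OS OZ); [now constructor|].
  cbn. apply derive_fam. split; [easy|]. intros b' n.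
  destruct (Bool.bool_dec b' pol) as [->|Hne].
  - destruct (Hz n) as [z [Az Cz]]. exists z. auto.
  - exists y. split; [easy|split; [apply agree_refl|]].
    replace b' with (negb pol); [easy|]. now destruct b', pol.
Qed.

(** * Rank bound from a truth-table reduction *)

Lemma coarse_of_tt f g a b :
  Baire1 g -> ~ Baire0 g -> is_brank f a -> is_brank g b ->
  tt_le f g -> ocoarse a b.
Proof.
  intros Hg1 Hg0 Ha Hb Htt c Hc.
  destruct (brank_lower f a c Ha Hc) as [p [e [x [He Hx]]]].
  destruct (Htt p e He) as [r [q [dl [k [h [Hdl [Hk Hh]]]]]]].
  assert (Hw : forall i, exists w, (i < r)%nat ->
     olt w b /\ forall z, ~ deriv_seq (fam g (q i) (dl i)) (OS w) z).
  { intros i. destruct (classic (i < r)%nat) as [Hi|Hi]; [|exists OZ; easy].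
    destruct (brank_bound g (q i) (dl i) b Hg1 (Hdl i Hi) Hb) as [w W]. eauto. }
  destruct (choice_fun _ Hw) as [w Hw']; clear Hw.
  (* Including [OS OZ] makes [d] at least 1, so that it has a leading power. *)
  destruct (finite_upper_bound b (OS OZ) r w (one_lt_brank g b Hg1 Hg0 Hb))
    as [d [D1 [D2 D3]]].
  { intros i Hi. now apply Hw'. }
  destruct (leading_power d D2) as [y [n [Y1 Y2]]].
  set (V := fun i a x => (i < r)%nat -> deriv_seq (fam g (q i) (dl i)) a (k i x)).
  assert (Vc : forall i a, closed (V i a)).
  { intros i o z Hz Hi. apply deriv_seq_closed. intros m.
    destruct (Hk i Hi z m) as [m' Hm]. destruct (Hz m') as [z' [Vz Az]].
    exists (k i z'). split; [now apply Vz|now apply Hm]. }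
  assert (Va : forall i a b z, ole a b -> V i b z -> V i a z).
  { intros i o o' z Ho Vz Hi. apply deriv_seq_anti with o'; auto. }
  assert (VL : forall i k, V i (OL k) = (fun z => forall n, V i (k n) z)).
  { intros i o. apply functional_extensionality. intros z.
    unfold V. cbn. apply propositional_extensionality. split; auto. }
  assert (Hcov := covers_opow_omega f p e r V y Vc Va VL
                    (covers_of_reduction f g p e r q dl k h Hk Hh)).
  (* If [c] reached this multiple, some question would gain more than [n] blocks at [x], beyond [d]
     and hence beyond the stage where its derivation is empty. *)
  set (m := S (r * n)).
  exists d, m. split; [easy|].
  apply olt_ole_trans with (omuln (opow_omega y) m); [|now apply omuln_mono_l].
  destruct (ole_or_olt (omuln (opow_omega y) m) c) as [L|L]; [|easy]. exfalso.
  destruct (derived_from_level_set f p e r V (opow_omega y) (fun _ => OZ) m x Vc Va Hcov)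
    as [s [S1 S2]].
  - apply deriv_seq_derived_from.
    + intros z i Hi Hi'. exact I.
    + now apply deriv_seq_anti with c.
  - destruct (nsum_pigeonhole s r n) as [i [Hi Hs]]; [exact S1|].
    apply (proj2 (Hw' i Hi) (k i x)). apply (Va i _ (oadd OZ (omuln (opow_omega y) (s i)))); auto.
    constructor. apply ole_olt_trans with d; [auto|].
    apply olt_ole_trans with (omuln (opow_omega y) n); [easy|].
    apply ole_trans with (omuln (opow_omega y) (s i)); [apply omuln_mono_r; lia|].
    apply ole_oadd_l.
Qed.

(** * From the bound on the rank to a reduction *)

(** The output rests at a discontinuity, where [pol] is forced, until the input is seen to leave
    [F]; then it jumps to a nearby point where [pol] is wrong. *)
Lemma membership_question g :
  ~ Baire0 g -> exists q d pol, (0 < d)%Q /\ forall F, closed F ->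
    exists k, cont_cantor k /\ forall x b, correct b (g (k x)) q d -> (b = pol <-> F x).
Proof.
  intros H. destruct (discontinuity_question g H) as [y [q [d [pol [Hd [Hy Hz]]]]]].
  exists q, d, pol. split; [easy|]. intros F HF.
  destruct (patch y (fun x j => forall z, agree x z j -> ~ F z)
              (fun _ z => ~ correct pol (g z) q d)) as [k [K1 [K2 K3]]].
  - intros t x j A Gt z Az. apply Gt. now apply agree_trans with x.
  - intros t j _. destruct (Hz j) as [z [Az Cz]]. exists (fun _ => z). split.
    + intros x m. exists O. intros; apply agree_refl.
    + auto.
  - exists k. split; [easy|]. intros x b C. split; intros E.
    + subst b. apply NNPP. intros N. destruct (closed_avoid F x HF N) as [j Hj].
      exact (K3 x j Hj C).
    + rewrite K2 in C.
      * destruct (Bool.bool_dec b pol) as [|Hne]; [easy|]. exfalso. apply Hy.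
        replace (negb pol) with b; [easy|]. now destruct b, pol.
      * intros j Gx. exact (Gx x (agree_refl x j) E).
Qed.

Definition answers (f g : Cantor -> R) (p e q d : Q) (x z : Cantor) : Prop :=
  forall b, correct b (g z) q d -> correct b (f x) p e.

(** Induction on [nu]. At a successor the output stays at [y] until a bit [b] is seen to suit [f] on
    stage [oadd th nu], moves to a nearby point forcing the answer [b], and follows the induction
    hypothesis once the input leaves that stage. Agreement with [y] up to [m], demanded of every
    [x], lets [patch] glue such maps. *)
Lemma reduce_block_local f p e g q d th nu :
  forall y t j m, deriv_seq (fam g q d) nu y ->
  (forall x, agree t x j -> ~ deriv_seq (fam f p e) (oadd th nu) x) ->
  exists k, cont_cantor k /\ forall x, agree y (k x) m /\
    (agree t x j -> deriv_seq (fam f p e) th x -> answers f g p e q d x (k x)).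
Proof.
  induction nu as [|nu IH|h IH]; intros y t j m Hy Ht.
  - exists (fun _ => y). split; [intros x n; exists O; intros; apply agree_refl|].
    (* As [oadd th OZ] is [th], the cylinder contains no point of stage [th]. *)
    intros x. split; [apply agree_refl|]. intros A Hx. exfalso. exact (Ht x A Hx).
  - set (F := deriv_seq (fam f p e) (oadd th nu)).
    cbn in Hy. apply derive_fam in Hy. destruct Hy as [Hy Hy2].
    destruct (patch y (fun x i => exists b, forall z, agree x z i -> F z -> correct b (f z) p e)
      (fun x z => agree y z m /\
         (deriv_seq (fam f p e) th x -> answers f g p e q d x z))) as [k [K1 [K2 K3]]].
    + intros s x i A [b Hb]. exists b. intros z Az. apply Hb. now apply agree_trans with x.
    + intros s i [b Hb].
      (* Since [negb b] is wrong at [y'], every correct bit there is [b]. *)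
      destruct (Hy2 (negb b) (Nat.max m i)) as [y' [Py' [Ay' Cy']]].
      (* While the input may still lie in [F], the output waits at [y']. *)
      destruct (patch y' (fun x l => forall z, agree x z l -> ~ F z)
        (fun x z => agree y z (Nat.max m i) /\
           (deriv_seq (fam f p e) th x -> answers f g p e q d x z)))
        as [k [K1 [K2 K3]]].
      * intros u x l A Gu z Az. apply Gu. now apply agree_trans with x.
      * intros u l Gu.
        destruct (IH y' u l (Nat.max (Nat.max m i) l) Py' Gu) as [k [K1 K2]].
        exists k. split; [easy|]. intros x Ax. destruct (K2 x) as [B1 B2]. split; [|split].
        -- eapply agree_le; [exact B1|lia].
        -- apply agree_trans with y'; [easy|]. eapply agree_le; [exact B1|lia].
        -- auto.
      * exists k. split; [easy|]. intros x Ax.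
        enough (E : agree y (k x) (Nat.max m i) /\
                    (deriv_seq (fam f p e) th x -> answers f g p e q d x (k x))).
        { destruct E as [E1 E2]. repeat split; [| |easy]; (eapply agree_le; [exact E1|lia]). }
        destruct (classic (F x)) as [Fx|Fx].
        -- rewrite K2 by (intros l Gl; exact (Gl x (agree_refl x l) Fx)).
           split; [easy|]. intros _ b' Cb'.
           destruct (Bool.bool_dec b' b) as [->|Hne]; [now apply Hb|].
           exfalso. apply Cy'. replace (negb b) with b'; [easy|]. now destruct b', b.
        -- destruct (closed_avoid F x (deriv_seq_closed _ _ _ _) Fx) as [l Hl].
           exact (K3 x l Hl).
    + exists k. split; [easy|]. intros x. split.
      * destruct (classic (exists i b, forall z, agree x z i -> F z -> correct b (f z) p e))
          as [[i Gi]|N]; [now apply (K3 x i)|].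
        rewrite K2 by (intros i Gi; eauto). apply agree_refl.
      * intros Ax. specialize (Ht x Ax). cbn in Ht. fold F in Ht.
        assert (E : exists i b, forall z, agree x z i -> F z -> correct b (f z) p e).
        { destruct (classic (F x)) as [Fx|Fx].
          - destruct (not_derive_fam _ _ _ _ _ Fx Ht) as [b [i Hi]]. eauto.
          - destruct (closed_avoid F x (deriv_seq_closed _ _ _ _) Fx) as [i Hi].
            (* No point of [F] is near [x], so either bit would do. *)
            exists i, true. intros z Az Fz. exfalso. exact (Hi z Az Fz). }
        destruct E as [i Gi]. now apply (K3 x i).
  (* A limit stage is left once some stage [h n] is seen to be left; the induction hypothesis for
     that [n] then takes over from [y]. *)
  - destruct (patch y (fun x i => exists n, forall z, agree x z i ->
                         ~ deriv_seq (fam f p e) (oadd th (h n)) z)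
      (fun x z => agree y z m /\
         (deriv_seq (fam f p e) th x -> answers f g p e q d x z))) as [k [K1 [K2 K3]]].
    + intros s x i A [n Hn]. exists n. intros z Az. apply Hn. now apply agree_trans with x.
    + intros s i [n Hn].
      destruct (IH n y s i (Nat.max m i) (Hy n) Hn) as [k [K1 K2]].
      exists k. split; [easy|]. intros x Ax. destruct (K2 x) as [B1 B2].
      repeat split; [| |auto]; (eapply agree_le; [exact B1|lia]).
    + exists k. split; [easy|]. intros x. split.
      * destruct (classic (exists i n, forall z, agree x z i ->
                             ~ deriv_seq (fam f p e) (oadd th (h n)) z))
          as [[i Gi]|N]; [now apply (K3 x i)|].
        rewrite K2 by (intros i Gi; eauto). apply agree_refl.
      * intros Ax. specialize (Ht x Ax). cbn in Ht.
        apply not_all_ex_not in Ht. destruct Ht as [n Hn].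
        destruct (closed_avoid _ x (deriv_seq_closed _ _ _ _) Hn) as [i Hi].
        apply (K3 x i). eauto.
Qed.

(** The complement of stage [oadd th nu] is open, so [patch] glues the local maps over its
    cylinders. *)
Lemma reduce_block f p e g q d th nu y :
  deriv_seq (fam g q d) nu y ->
  exists k, cont_cantor k /\ forall x, deriv_seq (fam f p e) th x ->
    ~ deriv_seq (fam f p e) (oadd th nu) x -> answers f g p e q d x (k x).
Proof.
  intros Hy.
  destruct (patch y
    (fun x i => forall z, agree x z i -> ~ deriv_seq (fam f p e) (oadd th nu) z)
    (fun x z => deriv_seq (fam f p e) th x -> answers f g p e q d x z)) as [k [K1 [_ K3]]].
  - intros s x i A G z Az. apply G. now apply agree_trans with x.
  - intros s i G. destruct (reduce_block_local f p e g q d th nu y s i i Hy G) as [k [K1 K2]].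
    exists k. split; [easy|]. intros x Ax. destruct (K2 x). auto.
  - exists k. split; [easy|]. intros x Tx Nx.
    destruct (closed_avoid _ x (deriv_seq_closed _ _ _ _) Nx) as [i Hi].
    now apply (K3 x i).
Qed.

(* Bit [j < n] of [sigma] equals [pol] iff the input lies in the [j]-th closed set,
   and bit [n + j] is reliable on the difference of the [j]-th and the next one. *)
Fixpoint last_block (pol : bool) (n : nat) (sigma : list bool) (m : nat) : bool :=
  match m with
  | O => false
  | S j => if Bool.eqb (nth j sigma false) pol then nth (n + j) sigma false
           else last_block pol n sigma j
  end.

Lemma tt_of_coarse f g a b :
  Baire1 f -> ~ Baire0 g -> is_brank f a -> is_brank g b ->
  ocoarse a b -> tt_le f g.
Proof.
  intros Hf1 Hg0 Ha Hb Hab p e He.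
  destruct (brank_bound f p e a Hf1 He Ha) as [c [C1 C2]].
  destruct (Hab c C1) as [d [n [D1 D2]]].
  destruct (brank_lower g b d Hb D1) as [q [dl [y [Hdl Hy]]]].
  destruct (membership_question g Hg0) as [q' [dl' [pol [Hdl' Hm]]]].
  set (F := fun j => deriv_seq (fam f p e) (omuln d j)).
  assert (HM : forall j, exists k, cont_cantor k /\
    forall x b, correct b (g (k x)) q' dl' -> (b = pol <-> F j x)).
  { intros j. apply Hm. apply deriv_seq_closed. }
  destruct (choice_fun _ HM) as [M HM']; clear HM.
  assert (HK : forall j, exists k, cont_cantor k /\
    forall x, F j x -> ~ F (S j) x -> answers f g p e q dl x (k x)).
  { intros j. exact (reduce_block f p e g q dl (omuln d j) d y Hy). }
  destruct (choice_fun _ HK) as [K HK']; clear HK.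
  exists (n + n)%nat, (fun i => if Nat.ltb i n then q' else q),
    (fun i => if Nat.ltb i n then dl' else dl),
    (fun i => if Nat.ltb i n then M i else K (i - n)%nat),
    (fun sigma => last_block pol n sigma n).
  split; [|split].
  - intros i _. now destruct (Nat.ltb i n).
  - intros i _. destruct (Nat.ltb i n); [apply HM'|apply HK'].
  - intros A sigma _ Hs.
    (* Stage [F n] is empty because [c] is below [omuln d n]. Scanning downwards from there, the
       first [F j] found to contain [A] puts [A] into the block between [F j] and [F (S j)]. *)
    enough (E : forall m, (m <= n)%nat -> ~ F m A -> correct (last_block pol n sigma m) (f A) p e).
    { apply E; [easy|]. intros Fn. apply (C2 A). apply deriv_seq_anti with (omuln d n); [|easy].
      now constructor. }
    induction m as [|m IH]; intros Hmn HF.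
    (* [F 0] is the whole space, so the default bit of [last_block] is never reached. *)
    + exfalso. apply HF. exact I.
    + cbn [last_block].
      assert (S1 := Hs m ltac:(lia)). assert (S2 := Hs (n + m)%nat ltac:(lia)).
      cbn beta in S1, S2.
      destruct (Nat.ltb_spec m n) as [_|L]; [|lia].
      destruct (Nat.ltb_spec (n + m) n) as [L|_]; [lia|].
      replace (n + m - n)%nat with m in S2 by lia.
      apply (proj2 (HM' m)) in S1.
      destruct (Bool.eqb_spec (nth m sigma false) pol) as [E|E].
      * apply (proj2 (HK' m)); [|easy|easy]. now apply S1.
      * apply IH; [lia|]. intros Fm. apply E. now apply S1.
Qed.

Theorem mainTheorem3 (f g : Cantor -> R)
  (hf1 : Baire1 f) (hf0 : ~ Baire0 f) (hg1 : Baire1 g) (hg0 : ~ Baire0 g)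
  (a b : Ord) (ha : is_brank f a) (hb : is_brank g b) :
  tt_le f g <-> ocoarse a b.
Proof.
  split.
  - now apply coarse_of_tt.
  - now apply tt_of_coarse.
Qed.
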